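(* Let $L$ be a binary $\mathbb{Z}_2$-lattice such that $\mathfrak{s}L = \mathbb{Z}_2$ and $\mathbb{Q}_2L$ is a hyperbolic plane. Let $s$ and $t$ be integers such that $t > 2s = \operatorname{ord}_2 dL$. Let $z$ be a primitive vector in $L$ with $\operatorname{ord}_2 Q(z) = t+1$, and let $w\in L$ satisfy $\operatorname{ord}_2 B(z,w) = t$. Then $\operatorname{ord}_2 Q(w)\ge t+2$.
   Context: A $\mathbb{Z}_2$-lattice is a finitely generated $\mathbb{Z}_2$-submodule of a quadratic space $(V,B)$ over $\mathbb{Q}_2$ with $Q(v)=B(v,v)$, assumed integral and nondegenerate. $\mathfrak{s}L=B(L,L)$ is the scale, $\mathbb{Q}_2L$ the space spanned by $L$, and $dL$ the determinant of a Gram matrix of $L$ (well defined up to unit squares). A vector $z$ is primitive if $\mathbb{Z}_2z$ is a direct summand of $L$. $\operatorname{ord}_2$ is the $2$-adic valuation (with $\operatorname{ord}_2 0=\infty$). *)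

(* Defs.v *)
(* The ring Z_2 of 2-adic integers is not in the installed
   libraries, so it is built here as the inverse limit  lim Z/2^n Z :
   an element is a sequence of integers (x_n) with x_{n+1} = x_n mod 2^n;
   two such sequences represent the same 2-adic integer iff x_n = y_n mod 2^n
   for all n (see z2eq).  *)
From mathcomp Require Import all_boot all_algebra.
Set Implicit Arguments.
Unset Strict Implicit.
Unset Printing Implicit Defensive.
Import GRing.Theory Num.Theory.
Local Open Scope ring_scope.

Definition p2 (n : nat) : int := (2 ^ n)%N%:Z.

Record Z2 := mkZ2 {
  z2s :> nat -> int ;
  z2P : forall n, (z2s n.+1 = z2s n %[mod p2 n])%Z }.

Lemma z2const_proof (k : int) : forall n : nat, ((fun _ : nat => k) n.+1 = (fun _ : nat => k) n %[mod p2 n])%Z.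
Proof. by []. Qed.
Definition z2const (k : int) : Z2 := mkZ2 (z2const_proof k).

Lemma z2add_proof (x y : Z2) : forall n, ((fun m => x m + y m) n.+1 = (fun m => x m + y m) n %[mod p2 n])%Z.
Proof. by move=> n; rewrite /= -modzDm (z2P x) (z2P y) modzDm. Qed.
Definition z2add (x y : Z2) : Z2 := mkZ2 (z2add_proof x y).

Lemma z2mul_proof (x y : Z2) : forall n, ((fun m => x m * y m) n.+1 = (fun m => x m * y m) n %[mod p2 n])%Z.
Proof. by move=> n; rewrite /= -modzMm (z2P x) (z2P y) modzMm. Qed.
Definition z2mul (x y : Z2) : Z2 := mkZ2 (z2mul_proof x y).

Lemma z2opp_proof (x : Z2) : forall n, ((fun m => - x m) n.+1 = (fun m => - x m) n %[mod p2 n])%Z.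
Proof. by move=> n; rewrite /= -modzNm (z2P x) modzNm. Qed.
Definition z2opp (x : Z2) : Z2 := mkZ2 (z2opp_proof x).

Definition z2sub (x y : Z2) : Z2 := z2add x (z2opp y).

Definition z2eq (x y : Z2) : Prop := forall n : nat, (x n = y n %[mod p2 n])%Z.

(* ord_2 x >= m  (for m : nat), i.e. x \in 2^m Z_2 ; true for all m iff x = 0 *)
Definition ord2_ge (x : Z2) (m : nat) : Prop := (p2 m %| x m)%Z.
(* ord_2 x = k, for k an integer (ord_2 0 = oo is never equal to an integer) *)
Definition ord2_eq (x : Z2) (k : int) : Prop :=
  exists n : nat, k = n%:Z /\ ord2_ge x n /\ ~ ord2_ge x n.+1.
(* ord_2 x >= k, for k an integer (always true when k <= 0) *)
Definition ord2_geZ (x : Z2) (k : int) : Prop :=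
  forall n : nat, k = n%:Z -> ord2_ge x n.

(* A binary Z_2-lattice L is free of rank 2; we fix a basis and describe L by
   its (integral, symmetric) Gram matrix [[a, b], [b, c]].  Vectors of L are
   coordinate pairs (v1, v2) in Z_2 x Z_2. *)
Record gram2 := Gram2 { ga : Z2 ; gb : Z2 ; gc : Z2 }.
Definition vec2 := (Z2 * Z2)%type.

Definition bil (G : gram2) (v w : vec2) : Z2 :=
  z2add (z2mul (ga G) (z2mul v.1 w.1))
   (z2add (z2mul (gb G) (z2add (z2mul v.1 w.2) (z2mul v.2 w.1)))
          (z2mul (gc G) (z2mul v.2 w.2))).
Definition qf (G : gram2) (v : vec2) : Z2 := bil G v v.
Definition dL (G : gram2) : Z2 := z2sub (z2mul (ga G) (gc G)) (z2mul (gb G) (gb G)).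

Definition nondeg2 (G : gram2) : Prop := ~ (forall m, ord2_ge (dL G) m).

(* sL = B(L, L) = Z_2 : the ideal generated by the values B(v,w) is all of
   Z_2, i.e. (Z_2 being local) some value B(v, w) is a unit (ord_2 = 0). *)
Definition scale_is_Z2 (G : gram2) : Prop :=
  exists v w : vec2, ord2_eq (bil G v w) 0.

(* Q_2 L is a hyperbolic plane: Q_2 L has a basis e, f with Q(e) = Q(f) = 0
   and B(e, f) = 1.  Clearing denominators (e, f can be scaled into L), this
   says: there are e, f in L with Q(e) = Q(f) = 0 and B(e, f) = 2^k for some
   k >= 0 (then e/2^k, f is a hyperbolic basis of Q_2 L; e, f are automatically
   independent since B(e,f) <> 0 = Q(e)). *)
Definition hyperbolic_plane (G : gram2) : Prop :=
  exists (e f : vec2) (k : nat),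
    z2eq (qf G e) (z2const 0) /\ z2eq (qf G f) (z2const 0) /\
    z2eq (bil G e f) (z2const (p2 k)).

(* z is primitive: Z_2 z is a direct summand of L, i.e. z can be completed to
   a basis {z, u} of L (the coordinate matrix [z u] is invertible over Z_2,
   i.e. its determinant is a unit). *)
Definition primitive (z : vec2) : Prop :=
  exists u : vec2, ord2_eq (z2sub (z2mul z.1 u.2) (z2mul z.2 u.1)) 0.

(* Main.v *)
(* Everything is read at a finite level 2^N, where L becomes the integral
   binary form with Gram matrix [[a, b], [b, c]].  The driving identity is
   Q(x) Q(y) - B(x, y)^2 = det(x, y)^2 dL.  For a hyperbolic pair e, f it shows
   that dL = 2^(2s) d with d = -1 mod 8.  For a complement u of z (det(z, u)
   odd) it gives ord B(z, u) = s, and then Cramer's rule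
   det(z, u) B(z, w) = det(w, u) Q(z) + det(z, w) B(z, u) gives
   ord det(z, w) = t - s.  Finally Q(z) Q(w) = B(z, w)^2 + det(z, w)^2 dL
   = 2^(2t) (g^2 + y^2 d) with g, y odd, and g^2 + y^2 d = 1 - 1 = 0 mod 8, so
   ord Q(z) Q(w) >= 2t + 3. *)

Require Import Defs.
From mathcomp Require Import all_boot all_algebra.
From mathcomp Require Import zify ring.
Set Implicit Arguments.
Unset Strict Implicit.
Unset Printing Implicit Defensive.
Import GRing.Theory Num.Theory.
Local Open Scope ring_scope.

Lemma p2D m n : p2 (m + n) = p2 m * p2 n.
Proof. by rewrite /p2 expnD PoszM. Qed.

Lemma p2S n : p2 n.+1 = 2 * p2 n.
Proof. by rewrite /p2 expnS PoszM. Qed.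

Lemma p2_neq0 n : p2 n != 0.
Proof. by rewrite /p2 eqz_nat expn_eq0. Qed.

Lemma p2_dvd m n : (m <= n)%N -> (p2 m %| p2 n)%Z.
Proof. by move=> le_mn; rewrite -(subnKC le_mn) p2D dvdz_mulr. Qed.

Definition oddz (o : int) := ~~ (2 %| o)%Z.

Definition ord2z (x : int) (n : nat) := exists2 o, oddz o & x = p2 n * o.

Lemma oddzM x y : oddz x -> oddz y -> oddz (x * y).
Proof. by rewrite /oddz !dvdzE /= !dvdn2 !negbK abszM oddM => -> ->. Qed.

Lemma odd_sqr_mod8 o : oddz o -> exists A, o ^+ 2 = 1 + 8 * A.
Proof.
rewrite /oddz => odd_o; have [r r_eq] : exists r, (r = o %% 8)%Z by exists (o %% 8)%Z.
have o_eq := divz_eq o 8; set q := (o %/ 8)%Z in o_eq; rewrite -r_eq in o_eq.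
have : r = 1 \/ r = 3 \/ r = 5 \/ r = 7 by lia.
by rewrite o_eq => -[|[|[|]]] ->;
  [exists (8*q*q + 2*q) | exists (8*q*q + 6*q + 1)
  | exists (8*q*q + 10*q + 3) | exists (8*q*q + 14*q + 6)]; ring.
Qed.

Lemma odd_sqr_add_mod8 g y d : oddz g -> oddz y -> (8 %| d + 1)%Z ->
  (8 %| g ^+ 2 + y ^+ 2 * d)%Z.
Proof.
move=> /odd_sqr_mod8[A ->] /odd_sqr_mod8[A' ->] /dvdzP[r d_eq].
have -> : d = r * 8 - 1 by rewrite -d_eq; ring.
by apply/dvdzP; exists (A + r + A' * (r * 8 - 1)); ring.
Qed.

Lemma p2_odd_inj i j o o' : oddz o -> oddz o' -> p2 i * o = p2 j * o' -> i = j /\ o = o'.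
Proof.
wlog le_ij : i j o o' / (i <= j)%N.
  move=> wlog_ij odd_o odd_o' eq_ij; case: (leqP i j) => [|/ltnW] le.
    exact: wlog_ij.
  by have [-> ->] := wlog_ij _ _ _ _ le odd_o' odd_o (esym eq_ij).
move=> odd_o odd_o'; rewrite -(subnKC le_ij) p2D -mulrA => /(mulfI (p2_neq0 i)).
case: (j - i)%N => [|n]; first by rewrite mul1r addn0.
by rewrite p2S -mulrA => o_eq; move: odd_o; rewrite /oddz o_eq dvdz_mulr.
Qed.

Lemma ord2z_uniq x i j : ord2z x i -> ord2z x j -> i = j.
Proof. by move=> [o odd_o ->] [o' odd_o' /(p2_odd_inj odd_o odd_o')[]]. Qed.

Lemma ord2z_neq0 x n : ord2z x n -> x != 0.
Proof.
move=> [o odd_o ->]; rewrite mulf_eq0 negb_or p2_neq0.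
by apply: contraNneq odd_o => ->.
Qed.

Lemma ord2z_exists x : x != 0 -> exists n, ord2z x n.
Proof.
move=> x_neq0; have [m] := @pfactor_coprime 2 `|x| isT (etrans (absz_gt0 x) x_neq0).
rewrite coprime2n => odd_m abs_x.
exists (logn 2 `|x|), (sgz x * m%:Z).
  rewrite /oddz dvdzE abszM /= dvdn2 negbK oddM odd_m andbT.
  by case: sgzP x_neq0.
by rewrite {1}(intEsg x) {1}abs_x PoszM /p2; ring.
Qed.

Lemma ord2zM x y i j : ord2z x i -> ord2z y j -> ord2z (x * y) (i + j).
Proof.
move=> [o odd_o ->] [o' odd_o' ->]; exists (o * o'); first exact: oddzM.
by rewrite p2D; ring.
Qed.

Lemma ord2zN x n : ord2z x n -> ord2z (- x) n.
Proof. by move=> [o odd_o ->]; exists (- o); [rewrite /oddz dvdzE abszN | ring]. Qed.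

Lemma ord2zD_dvd x y n : ord2z x n -> (p2 n.+1 %| y)%Z -> ord2z (x + y) n.
Proof.
move=> [o odd_o ->] /dvdzP[q ->]; exists (o + 2 * q).
  by move: odd_o; rewrite /oddz; lia.
by rewrite p2S; ring.
Qed.

Lemma ord2zMl_cancel x y i n : ord2z (x * y) n -> ord2z x i ->
  exists2 j, (i + j)%N = n & ord2z y j.
Proof.
move=> ord_xy ord_x; have [|j ord_y] := ord2z_exists (x := y).
  by apply: contraNneq (ord2z_neq0 ord_xy) => ->; rewrite mulr0.
by exists j => //; apply: ord2z_uniq (ord2zM ord_x ord_y) ord_xy.
Qed.

Lemma ord2z_sqr x n : ord2z (x ^+ 2) (n + n) -> ord2z x n.
Proof.
move=> ord_x2; have [|j ord_x] := ord2z_exists (x := x).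
  by apply: contraNneq (ord2z_neq0 ord_x2) => ->; rewrite expr0n.
by have := ord2z_uniq (ord2zM ord_x ord_x) ord_x2 => jj_eq; have <- : j = n by lia.
Qed.

Lemma dvdz_sub_level (x : Z2) m n : (m <= n)%N -> (p2 m %| x n - x m)%Z.
Proof.
elim: n => [|n IHn]; first by rewrite leqn0 => /eqP ->; rewrite subrr.
rewrite leq_eqVlt ltnS => /predU1P[-> //|le_mn]; first by rewrite subrr.
have -> : x n.+1 - x m = (x n.+1 - x n) + (x n - x m) by ring.
rewrite rpredD ?IHn //; apply: dvdz_trans (p2_dvd le_mn) _.
by rewrite -eqz_mod_dvd; apply/eqP; exact: z2P.
Qed.

Lemma dvdz_level (x : Z2) m n : (m <= n)%N -> (p2 m %| x n)%Z = (p2 m %| x m)%Z.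
Proof.
by move=> le_mn; rewrite -[x n](subrK (x m)) rpredDl ?dvdz_sub_level.
Qed.

Lemma ord2_eq_level (x : Z2) (n N : nat) : ord2_eq x n -> (n < N)%N -> ord2z (x N) n.
Proof.
move=> [_ [[<-] [ge_n not_ge_Sn]]] lt_nN.
have /dvdzP[o x_eq] : (p2 n %| x N)%Z by rewrite dvdz_level // ltnW.
exists o; last by rewrite x_eq mulrC.
apply/negP => /dvdzP[o' o_eq]; apply: not_ge_Sn.
by rewrite /ord2_ge -(dvdz_level _ lt_nN) x_eq o_eq p2S; apply/dvdzP; exists o'; ring.
Qed.

Lemma coprimez_p2_odd n o : oddz o -> coprimez (p2 n) o.
Proof.
by rewrite /oddz dvdzE dvdn2 negbK coprimezE => odd_o; rewrite coprimeXl ?coprime2n.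
Qed.

Lemma sqr_mul_odd_m1_mod8 x m k d X : oddz d ->
  x ^+ 2 * (p2 m * d) = p2 (k + k) * (8 * X - 1) -> (8 %| d + 1)%Z.
Proof.
move=> odd_d eq_x.
have odd_X : oddz (8 * X - 1) by rewrite /oddz; lia.
have ord_lhs : ord2z (x ^+ 2 * (p2 m * d)) (k + k) by exists (8 * X - 1).
have [|j [x' odd_x' x_eq]] := ord2z_exists (x := x).
  by apply: contraNneq (ord2z_neq0 ord_lhs) => ->; rewrite expr0n mul0r.
have [_ x'_eq] : (j + j + m)%N = (k + k)%N /\ x' ^+ 2 * d = 8 * X - 1.
  apply: p2_odd_inj => //; first by apply: oddzM => //; apply: oddzM.
  by rewrite -eq_x x_eq !p2D; ring.
have [A sqr_x'] := odd_sqr_mod8 odd_x'.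
apply/dvdzP; exists (X - A * d).
transitivity (x' ^+ 2 * d - 8 * A * d + 1); first by rewrite sqr_x'; ring.
by rewrite x'_eq; ring.
Qed.

Section IntegralBinaryForm.

Variables a b c : int.

Definition bform (x y : int * int) : int :=
  a * (x.1 * y.1) + (b * (x.1 * y.2 + x.2 * y.1) + c * (x.2 * y.2)).
Definition qform (x : int * int) : int := bform x x.
Definition det2 (x y : int * int) : int := x.1 * y.2 - x.2 * y.1.
Definition disc : int := a * c - b * b.

Lemma qform_mul_sub_sqr x y :
  qform x * qform y - bform x y ^+ 2 = det2 x y ^+ 2 * disc.
Proof. by rewrite /qform /bform /det2 /disc; ring. Qed.

Lemma det2_mul_bform x y z :
  det2 x y * bform x z = det2 z y * qform x + det2 x z * bform x y.
Proof. by rewrite /qform /bform /det2; ring. Qed.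

Lemma hyperbolic_disc_odd_part_mod8 e f (k N m : nat) d :
  (k + k + 3 <= N)%N ->
  (qform e = 0 %[mod p2 N])%Z -> (qform f = 0 %[mod p2 N])%Z ->
  (bform e f = p2 k %[mod p2 N])%Z ->
  disc = p2 m * d -> oddz d -> (8 %| d + 1)%Z.
Proof.
move=> le_kN /eqP + /eqP + /eqP; rewrite !eqz_mod_dvd !subr0.
move=> /dvdzP[x qe_eq] /dvdzP[y qf_eq] /dvdzP[g bef_eq] disc_eq odd_d.
have pN_eq : p2 N = p2 k ^+ 2 * (8 * p2 (N - (k + k + 3))).
  by rewrite -[8]/(p2 3) expr2 -!p2D; congr p2; lia.
set P := p2 (N - _) in pN_eq.
apply: (@sqr_mul_odd_m1_mod8 (det2 e f) m k d
  (8 * P ^+ 2 * p2 k ^+ 2 * (x * y - g ^+ 2) - 2 * g * p2 k * P)) => //.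
rewrite -disc_eq -qform_mul_sub_sqr qe_eq qf_eq -[bform e f](subrK (p2 k)) bef_eq.
by rewrite pN_eq p2D; ring.
Qed.

Lemma ord2z_bform_complement z u (s t : nat) :
  (s + s <= t)%N -> ord2z disc (s + s) -> ord2z (det2 z u) 0 -> ord2z (qform z) t.+1 ->
  ord2z (bform z u) s.
Proof.
move=> le_st ord_d ord_det [q _ qz_eq]; apply: ord2z_sqr.
have -> : bform z u ^+ 2 = - (det2 z u ^+ 2 * disc) + qform z * qform u.
  by rewrite -qform_mul_sub_sqr; ring.
apply: ord2zD_dvd; first exact: ord2zN (ord2zM (ord2zM ord_det ord_det) ord_d).
by rewrite qz_eq -mulrA dvdz_mulr // p2_dvd.
Qed.

Lemma ord2z_det2 z u w (s t : nat) :
  ord2z (bform z u) s -> ord2z (det2 z u) 0 -> ord2z (qform z) t.+1 ->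
  ord2z (bform z w) t -> exists2 j, (s + j)%N = t & ord2z (det2 z w) j.
Proof.
move=> ord_zu ord_det [q _ qz_eq] ord_zw; apply: ord2zMl_cancel ord_zu.
have -> : bform z u * det2 z w = det2 z u * bform z w + - (det2 w u * qform z).
  by rewrite det2_mul_bform; ring.
apply: ord2zD_dvd; first exact: ord2zM ord_det ord_zw.
by rewrite rpredN qz_eq dvdz_mull // dvdz_mulr.
Qed.

Lemma qform_dvd_of_det2 z w (s j : nat) d :
  disc = p2 (s + s) * d -> (8 %| d + 1)%Z ->
  ord2z (qform z) (s + j).+1 -> ord2z (bform z w) (s + j) -> ord2z (det2 z w) j ->
  (p2 (s + j).+2 %| qform w)%Z.
Proof.
move=> disc_eq d_mod8 [q odd_q qz_eq] [g odd_g zw_eq] [y odd_y det_eq].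
have /dvdzP[W gy_eq] := odd_sqr_add_mod8 odd_g odd_y d_mod8.
have qw_eq : p2 (s + j).+1 * (q * qform w) = p2 (s + j).+1 * (p2 (s + j).+2 * W).
  rewrite mulrA -qz_eq.
  have -> : qform z * qform w = bform z w ^+ 2 + det2 z w ^+ 2 * disc.
    by rewrite -qform_mul_sub_sqr; ring.
  transitivity (p2 (s + j) ^+ 2 * (g ^+ 2 + y ^+ 2 * d)).
    by rewrite zw_eq det_eq disc_eq !p2D; ring.
  by rewrite gy_eq !p2S; ring.
have : (p2 (s + j).+2 %| q * qform w)%Z by rewrite (mulfI (p2_neq0 _) qw_eq) dvdz_mulr.
by rewrite Gauss_dvdzr // coprimez_p2_odd.
Qed.

Theorem qform_ord2_ge e f (k N : nat) z u w (s t : nat) :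
  (k + k + 3 <= N)%N ->
  (qform e = 0 %[mod p2 N])%Z -> (qform f = 0 %[mod p2 N])%Z ->
  (bform e f = p2 k %[mod p2 N])%Z ->
  (s + s <= t)%N -> ord2z disc (s + s) -> ord2z (det2 z u) 0 ->
  ord2z (qform z) t.+1 -> ord2z (bform z w) t ->
  (p2 t.+2 %| qform w)%Z.
Proof.
move=> le_kN qe0 qf0 bef le_st ord_d ord_det ord_qz ord_zw.
have ord_zu := ord2z_bform_complement le_st ord_d ord_det ord_qz.
have [j sj_eq ord_zw_det] := ord2z_det2 ord_zu ord_det ord_qz ord_zw; subst t.
have [d odd_d disc_eq] := ord_d.
have d_mod8 := hyperbolic_disc_odd_part_mod8 le_kN qe0 qf0 bef disc_eq odd_d.
exact: qform_dvd_of_det2 disc_eq d_mod8 ord_qz ord_zw ord_zw_det.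
Qed.

End IntegralBinaryForm.

Theorem lemma6p4 (G : gram2) (s t : int) (z w : vec2) :
  nondeg2 G ->
  scale_is_Z2 G ->
  hyperbolic_plane G ->
  2 * s < t ->
  ord2_eq (dL G) (2 * s) ->
  primitive z ->
  ord2_eq (qf G z) (t + 1) ->
  ord2_eq (bil G z w) t ->
  ord2_geZ (qf G w) (t + 2).
Proof.
move=> _ _ [e [f [k [qe0 [qf0 bef]]]]] lt_st ord_d [u ord_det] ord_qz ord_zw.
have [n [t_eq _]] := ord_zw; have [m [ds_eq _]] := ord_d; subst t.
have s_nat : 2 * s = (`|s| + `|s|)%N by lia.
have t1_nat : n%:Z + 1 = n.+1 by lia.
rewrite s_nat in lt_st ord_d; rewrite t1_nat in ord_qz.
move=> n2 n2_eq; have -> : n2 = n.+2 by lia.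
pose N := (n + k + k + 3)%N; pose at_level (v : vec2) := (v.1 N, v.2 N).
rewrite /ord2_ge -(@dvdz_level _ n.+2 N); last by lia.
apply: (@qform_ord2_ge (ga G N) (gb G N) (gc G N) (at_level e) (at_level f) k N
  (at_level z) (at_level u) (at_level w) `|s| n _ (qe0 N) (qf0 N) (bef N) _
  (ord2_eq_level ord_d _) (ord2_eq_level ord_det _) (ord2_eq_level ord_qz _)
  (ord2_eq_level ord_zw _)); lia.
Qed.
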